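(* Let $(h,\vec v)$ be a smooth solution of the shallow water equations in covariant form on a two-dimensional surface $S\subset\mathbb R^3$, and let $\tau^{ij}=hv^iv^j+\frac g2h^2G^{ij}$ be the contravariant components of the momentum flux tensor. Then, for $i\in\{1,2\}$, the divergence of the momentum flux can be expressed as $$\nabla_j\tau^{ij}=\frac1{2J}\Big(\partial_j(Jhv^iv^j)+v^i\partial_j(Jhv^j)+G^{ik}Jhv^j\partial_jv_k\Big)+gG^{ij}h\,\partial_jh+\frac12\Big(\Gamma^i_{jk}hv^jv^k-G^{ik}\Gamma^l_{jk}hv^jv_l\Big).$$
   Context: Summation over Latin indices in $\{1,2\}$ repeated in upper and lower positions is implied. $S\subset\mathbb R^3$ is a surface locally parametrized by a smooth, bijective, time-invariant map $\vec X$ from a reference domain in $\mathbb R^2$ with coordinates $\xi^1,\xi^2$; $\partial_i$ is the partial derivative with respect to $\xi^i$. Covariant basis $\vec a_i=\partial_i\vec X$, metric $G_{ij}=\vec a_i\cdot\vec a_j$, assumed symmetric positive definite, with inverse $(G^{ij})$, and $J=\sqrt{\det(G_{ij})}$. Christoffel symbols: $\Gamma^i_{jk}=\frac12G^{il}(\partial_jG_{kl}+\partial_kG_{jl}-\partial_lG_{jk})$. Covariant derivatives: $\nabla_kv^i=\partial_kv^i+\Gamma^i_{jk}v^j$ and $\nabla_k\tau^{ij}=\partial_k\tau^{ij}+\Gamma^i_{kl}\tau^{lj}+\Gamma^j_{kl}\tau^{il}$. Velocity $\vec v=v^i\vec a_i$, covariant components $v_i=G_{ij}v^j$. $h>0$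 is the fluid depth and $g>0$ is constant. The covariant shallow water equations are $$\partial_th+\nabla_j(hv^j)=0,\qquad \partial_t(hv^i)+\nabla_j\tau^{ij}=-fJG^{ij}\varepsilon_{jk}hv^k-ghG^{ij}\partial_jb,$$ where $b$ is the bottom topography, $f$ the Coriolis parameter (both spatially varying), and $\varepsilon_{12}=1$, $\varepsilon_{21}=-1$, $\varepsilon_{11}=\varepsilon_{22}=0$. *)

(* Defs.v *)
From HB Require Import structures.
From mathcomp Require Import all_boot all_order all_algebra.
From mathcomp Require Import all_classical all_reals all_analysis.
Set Implicit Arguments.
Unset Strict Implicit.
Unset Printing Implicit Defensive.
Import Order.TTheory GRing.Theory Num.Theory.
Import numFieldNormedType.Exports.
Local Open Scope classical_set_scope.
Local Open Scope ring_scope.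

(* For V finite-dimensional and U open, differentiability of all iterated
   directional derivatives is the usual C^infinity regularity. *)
Definition smooth_on (R : realType) (V W : normedModType R)
    (U : set V) (F : V -> W) : Prop :=
  forall (es : seq V) (p : V), U p ->
    differentiable (foldr (fun e G => 'D_e G) F es) p.

Section Geometry.
Context {R : realType}.
Local Notation point2 := 'rV[R]_2.
Local Notation point3 := 'rV[R]_3.
Local Notation field := (point2 -> R).

(* The coordinates xi^1, xi^2 are the entries 0 and 1 of the row vector. *)
Definition partial (W : normedModType R) (i : 'I_2) (F : point2 -> W) :
  point2 -> W := 'D_(delta_mx 0 i) F.

Definition dot3 (u w : point3) : R := \sum_(k < 3) u 0 k * w 0 k.

Definition basis (X : point2 -> point3) (i : 'I_2) : point2 -> point3 :=
  partial i X.

Definition metric (X : point2 -> point3) (x : point2) : 'M[R]_2 :=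
  \matrix_(i, j) dot3 (basis X i x) (basis X j x).

Definition Gdown (X : point2 -> point3) (i j : 'I_2) : field :=
  fun x => metric X x i j.

Definition Gup (X : point2 -> point3) (i j : 'I_2) : field :=
  fun x => invmx (metric X x) i j.

Definition Jac (X : point2 -> point3) : field :=
  fun x => Num.sqrt (\det (metric X x)).

(* christoffel X i j k is Gamma^i_{jk}. *)
Definition christoffel (X : point2 -> point3) (i j k : 'I_2) : field :=
  fun x => 2^-1 * \sum_(l < 2) Gup X i l x *
    (partial j (Gdown X k l) x + partial k (Gdown X j l) x
     - partial l (Gdown X j k) x).

(* covd1 X u k i is nabla_k u^i. *)
Definition covd1 (X : point2 -> point3) (u : 'I_2 -> field) (k i : 'I_2) :
    field :=
  fun x => partial k (u i) x + \sum_(j < 2) christoffel X i j k x * u j x.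

(* covd2 X T k i j is nabla_k T^{ij}. *)
Definition covd2 (X : point2 -> point3) (T : 'I_2 -> 'I_2 -> field)
    (k i j : 'I_2) : field :=
  fun x => partial k (T i j) x
    + \sum_(l < 2) christoffel X i k l x * T l j x
    + \sum_(l < 2) christoffel X j k l x * T i l x.

Definition lower (X : point2 -> point3) (u : 'I_2 -> field) (i : 'I_2) :
    field :=
  fun x => \sum_(j < 2) Gdown X i j x * u j x.

Definition sym_pos_def (A : 'M[R]_2) : Prop :=
  A^T = A /\ forall u : point2, u != 0 -> 0 < (u *m A *m u^T) 0 0.

(* X maps Omega bijectively onto a relatively open patch of S. *)
Definition local_param (S : set point3) (Omega : set point2)
    (X : point2 -> point3) : Prop :=
  [/\ open Omega,
      smooth_on Omega X,
      exists2 N : set point3, open N & set_bij Omega (S `&` N) X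
    & forall x, Omega x -> sym_pos_def (metric X x)].

Definition surface (S : set point3) : Prop :=
  forall p, S p -> exists (Omega : set point2) (X : point2 -> point3),
    local_param S Omega X /\ (X @` Omega) p.

Definition eps (j k : 'I_2) : R := (j < k)%:R - (k < j)%:R.

Definition momentum_flux (X : point2 -> point3) (g : R) (h : field)
    (v : 'I_2 -> field) (i j : 'I_2) : field :=
  fun x => h x * v i x * v j x + g / 2 * h x ^+ 2 * Gup X i j x.

(* Here v t i x is the contravariant component v^i at time t and point x. *)
Definition shallow_water (X : point2 -> point3) (g : R) (f b : field)
    (h : R -> field) (v : R -> 'I_2 -> field) (t : R) (x : point2) : Prop :=
  (derive1 (fun s => h s x) t
     + \sum_(j < 2) covd1 X (fun i y => h t y * v t i y) j j x = 0)
  /\ forall i : 'I_2,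
     derive1 (fun s => h s x * v s i x) t
       + \sum_(j < 2) covd2 X (momentum_flux X g (h t) (v t)) j i j x
     = - (\sum_(j < 2) \sum_(k < 2)
            f x * Jac X x * Gup X i j x * eps j k * h t x * v t k x)
       - \sum_(j < 2) g * h t x * Gup X i j x * partial j b x.

(* (h, w) is a smooth solution over the time set I in the chart (Omega, X), and
   the v t i are the contravariant components of the velocity vector w t. *)
Record smooth_solution (I : set R) (Omega : set point2)
    (X : point2 -> point3) (g : R) (f b : field)
    (h : R -> field) (w : R -> point2 -> point3) (v : R -> 'I_2 -> field) :
    Prop := SmoothSolution {
  depth_smooth :
    smooth_on (I `*` Omega) (fun p : R * point2 => h p.1 p.2);
  velocity_smooth :
    smooth_on (I `*` Omega) (fun p : R * point2 => w p.1 p.2);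
  velocity_components : forall t x, I t -> Omega x ->
    w t x = \sum_(i < 2) v t i x *: basis X i x;
  depth_gt0 : forall t x, I t -> Omega x -> 0 < h t x;
  topography_differentiable : forall x, Omega x -> differentiable b x;
  equations : forall t x, I t -> Omega x -> shallow_water X g f b h v t x
}.

End Geometry.

(* Main.v *)
Require Import Defs.
From HB Require Import structures.
From mathcomp Require Import all_boot all_order all_algebra.
From mathcomp Require Import all_classical all_reals all_analysis.
From mathcomp Require Import ring lra.
Set Implicit Arguments.
Unset Strict Implicit.
Unset Printing Implicit Defensive.
Import Order.TTheory GRing.Theory Num.Theory.
Import numFieldNormedType.Exports.
Local Open Scope classical_set_scope.
Local Open Scope ring_scope.

(** The equality is an identity between first derivatives at a point of the
    domain.  It splits along the two parts of the flux.

    The pressure part rests on metric compatibility: the Christoffel symbols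
    are built so that the metric, hence its inverse, is covariantly constant
    ([partial_Gdown], [partial_Gup]).  The divergence of p G^{ij} is therefore
    G^{ij} d_j p ([covd2_pressure]), and p = g h^2 / 2 gives the term with the
    gradient of the depth.

    The advective part h v^i v^j is the half-sum of two of its expressions.
    - In conservative form the trace of the Christoffel symbols is absorbed by
      the volume element, because d_k J = J Gamma^l_{kl} ([partial_Jac]):
      the divergence is (1/J) d_j (J h v^i v^j) + Gamma^i_{jk} h v^j v^k
      ([divergence_tensor]).
    - The product rule replaces d_j (J h v^i v^j) by
      v^i d_j (J h v^j) + J h v^j d_j v^i.  Writing v^i = G^{ik} v_k and using
      compatibility again, d_j v^i is G^{ik} d_j v_k up to Christoffel terms
      ([partial_component]).
    In the half-sum ([divergence_advection]) the coefficient of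
    Gamma^i_{jk} h v^j v^k is 1 - 1/2.

    All this needs the fields to be differentiable.  For the contravariant
    velocity components this comes from v^i = G^{ij} (a_j . v), the velocity
    vector and the covariant basis being smooth ([components_has_partials]). *)

(** * Partial derivatives of fields on the reference domain *)

Section Partials.
Context {R : realType}.
Local Notation point2 := 'rV[R]_2.
Local Notation field := (point2 -> R).
Implicit Types (F G H : field) (x : point2) (k : 'I_2).

Definition has_partials (W : normedModType R) (F : point2 -> W) x : Prop :=
  forall k, derivable F x (delta_mx 0 k : point2).

Lemma differentiable_has_partials (W : normedModType R) (F : point2 -> W) x :
  differentiable F x -> has_partials F x.
Proof. by move=> dF k; exact: diff_derivable. Qed.

Lemma has_partials_entry m (F : point2 -> 'rV[R]_m) (i : 'I_m) x :
  has_partials F x -> has_partials (fun y => F y 0 i) x.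
Proof. by move=> dF k; exact: (derivable_mxP _ _ _).1 (dF k) 0 i. Qed.

Lemma has_partials_cst (c : R) x : has_partials (fun=> c) x.
Proof. by move=> k; exact: derivable_cst. Qed.

Lemma has_partialsD F G x : has_partials F x -> has_partials G x ->
  has_partials (fun y => F y + G y) x.
Proof. by move=> dF dG k; exact: derivableD. Qed.

Lemma has_partialsM F G x : has_partials F x -> has_partials G x ->
  has_partials (fun y => F y * G y) x.
Proof. by move=> dF dG k; exact: derivableM. Qed.

Lemma has_partials_sum n (F : 'I_n -> field) x :
  (forall i, has_partials (F i) x) ->
  has_partials (fun y => \sum_(i < n) F i y) x.
Proof.
move=> dF k.
have -> : (fun y => \sum_(i < n) F i y) = \sum_(i < n) F i.
  by apply/funext => y; rewrite fct_sumE.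
by apply: derivable_sum => i; exact: dF.
Qed.

Lemma dot3C (u w : 'rV[R]_3) : dot3 u w = dot3 w u.
Proof. by apply: eq_bigr => r _; rewrite mulrC. Qed.

Lemma dot3_sumr n (e : 'rV[R]_3) (c : 'I_n -> R) (a : 'I_n -> 'rV[R]_3) :
  dot3 e (\sum_(k < n) c k *: a k) = \sum_(k < n) c k * dot3 e (a k).
Proof.
rewrite /dot3; under eq_bigr => r _ do rewrite summxE mulr_sumr.
rewrite exchange_big; apply: eq_bigr => k _; rewrite mulr_sumr.
by apply: eq_bigr => r _; rewrite !mxE mulrCA.
Qed.

Lemma dot3_has_partials (u w : point2 -> 'rV[R]_3) x :
  has_partials u x -> has_partials w x ->
  has_partials (fun y => dot3 (u y) (w y)) x.
Proof.
move=> du dw; apply: has_partials_sum => r.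
by apply: has_partialsM; exact: has_partials_entry.
Qed.

Lemma has_partialsV F x : F x != 0 -> has_partials F x ->
  has_partials (fun y => (F y)^-1) x.
Proof. by move=> F0 dF k; exact: derivableV. Qed.

(** Along a line through [x] this is the chain rule for functions of one real
    variable. *)
Lemma has_partials_sqrt F x : 0 < F x -> has_partials F x ->
  has_partials (fun y => Num.sqrt (F y)) x.
Proof.
move=> F0 dF k; apply/derivable1P/derivable1_diffP.
apply: (@differentiable_comp _ _ _ _
  (fun h : R => F (h *: (delta_mx 0 k : point2) + x)) (@Num.sqrt R)).
  exact/derivable1_diffP/(derivable1P _ _ _).1/dF.
apply/derivable1_diffP; rewrite scale0r add0r.
by have [] := is_derive1_sqrt F0.
Qed.

Lemma has_partials_near F G x : (\near x, F x = G x) ->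
  has_partials F x -> has_partials G x.
Proof. by move=> FG dF k; exact: near_eq_derivable (dF k). Qed.

Lemma partial_near F G x k : (\near x, F x = G x) ->
  partial k F x = partial k G x.
Proof. exact: near_eq_derive. Qed.

Lemma partial_cst (c : R) x k : partial k (fun=> c) x = 0.
Proof. exact: derive_cst. Qed.

Lemma partialD F G x k : has_partials F x -> has_partials G x ->
  partial k (fun y => F y + G y) x = partial k F x + partial k G x.
Proof. by move=> dF dG; exact: deriveD. Qed.

Lemma partialM F G x k : has_partials F x -> has_partials G x ->
  partial k (fun y => F y * G y) x =
  F x * partial k G x + partial k F x * G x.
Proof.
move=> dF dG; rewrite [RHS]addrC [_ * G x]mulrC [RHS]addrC.
exact: deriveM.
Qed.

Lemma partial_sum n (F : 'I_n -> field) x k :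
  (forall i, has_partials (F i) x) ->
  partial k (fun y => \sum_(i < n) F i y) x = \sum_(i < n) partial k (F i) x.
Proof.
move=> dF.
have -> : (fun y => \sum_(i < n) F i y) = \sum_(i < n) F i.
  by apply/funext => y; rewrite fct_sumE.
by apply: derive_sum => i; exact: dF.
Qed.

(** The determinant of a symmetric matrix of order two has this shape. *)
Lemma has_partials_discriminant F G H x :
  has_partials F x -> has_partials G x -> has_partials H x ->
  has_partials (fun y => F y * G y + (- 1) * (H y * H y)) x.
Proof.
move=> dF dG dH; apply: has_partialsD; first exact: has_partialsM.
by apply: has_partialsM; [exact: has_partials_cst|exact: has_partialsM].
Qed.

Lemma partial_discriminant F G H x k :
  has_partials F x -> has_partials G x -> has_partials H x ->
  partial k (fun y => F y * G y + (- 1) * (H y * H y)) x =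
  F x * partial k G x + partial k F x * G x - 2 * (H x * partial k H x).
Proof.
move=> dF dG dH.
have dc : has_partials (fun=> - 1 : R) x by exact: has_partials_cst.
have dFG := has_partialsM dF dG.
have dHH := has_partialsM dH dH.
have dcHH := has_partialsM dc dHH.
by rewrite partialD// !partialM// partial_cst; ring.
Qed.

End Partials.

(** * Positive definite matrices of order two *)

Section Order2.
Context {R : realType}.

Lemma sum2 (F : 'I_2 -> R) : \sum_(i < 2) F i = F ord0 + F ord_max.
Proof. by rewrite big_ord_recr big_ord1 /=; congr (F _ + _); apply/val_inj. Qed.

Lemma sum_deltal n (i : 'I_n) (F : 'I_n -> R) :
  \sum_(l < n) (i == l)%:R * F l = F i.
Proof.
rewrite (bigD1 i)//= eqxx mul1r big1 ?addr0// => l /negPf.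
by rewrite eq_sym => ->; rewrite mul0r.
Qed.

Lemma sum_deltar n (j : 'I_n) (F : 'I_n -> R) :
  \sum_(l < n) F l * (l == j)%:R = F j.
Proof.
by under eq_bigr => l _ do rewrite mulrC eq_sym; exact: sum_deltal.
Qed.

Lemma det2 (A : 'M[R]_2) :
  \det A = A ord0 ord0 * A ord_max ord_max - A ord0 ord_max * A ord_max ord0.
Proof.
rewrite (expand_det_row _ ord0) sum2 /cofactor !det_mx11 !mxE /=.
rewrite expr0 expr1 mul1r mulN1r mulrN.
by congr (_ * A _ _ - _ * A _ _); apply/val_inj.
Qed.

Lemma sym_pos_def_det_gt0 (A : 'M[R]_2) : sym_pos_def A -> 0 < \det A.
Proof.
move=> [Asym Apos].
have A10 : A ord_max ord0 = A ord0 ord_max by rewrite -{1}Asym mxE.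
have quad (u : 'rV[R]_2) : (u *m A *m u^T) 0 0 =
    u 0 ord0 ^+ 2 * A ord0 ord0 + 2 * u 0 ord0 * u 0 ord_max * A ord0 ord_max
    + u 0 ord_max ^+ 2 * A ord_max ord_max.
  by rewrite !mxE sum2 !mxE !sum2 A10; ring.
have A00 : 0 < A ord0 ord0.
  have := Apos (delta_mx 0 ord0); rewrite quad !mxE /=.
  have -> : (delta_mx 0 ord0 : 'rV[R]_2) != 0.
    by apply/eqP => /matrixP /(_ 0 ord0) /eqP; rewrite !mxE /= oner_eq0.
  by move=> /(_ isT); rewrite expr0n expr1n /=; lra.
(* The second column of the adjugate of A: there the form takes the value
   A 0 0 * det A. *)
pose u : 'rV[R]_2 := \row_j (if j == ord0 then - A ord0 ord_max
                             else A ord0 ord0).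
have u0 : u != 0.
  apply/eqP => /matrixP /(_ 0 ord_max) /eqP.
  by rewrite !mxE /= gt_eqF.
have := Apos _ u0; rewrite quad !mxE /= det2 A10.
set a := A ord0 ord0 in A00 *; set c := A ord0 ord_max; set d := A ord_max _.
have -> : (- c) ^+ 2 * a + 2 * - c * a * c + a ^+ 2 * d = a * (a * d - c * c).
  by ring.
by rewrite pmulr_rgt0.
Qed.

End Order2.

(** * Differential calculus of the metric *)

Section Metric.
Context {R : realType} {Omega : set 'rV[R]_2} {X : 'rV[R]_2 -> 'rV[R]_3}.
Context (oO : open Omega) (smX : smooth_on Omega X).
Context (spd : forall x, Omega x -> sym_pos_def (metric X x)).
Implicit Types (x : 'rV[R]_2) (i j k l m : 'I_2).

(** Identities that hold on the whole domain may be differentiated there. *)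
Lemma near_Omega x (P : 'rV[R]_2 -> Prop) : Omega x ->
  (forall y, Omega y -> P y) -> \near x, P x.
Proof.
move=> Ox OP; have : \near x, Omega x by exact: open_nbhs_nbhs.
exact: filterS.
Qed.

Lemma basis_has_partials x i : Omega x -> has_partials (Defs.basis X i) x.
Proof.
by move=> Ox; apply: differentiable_has_partials; exact: (smX [:: delta_mx 0 i]).
Qed.

Lemma GdownE i j x : Gdown X i j x = dot3 (Defs.basis X i x) (Defs.basis X j x).
Proof. by rewrite /Gdown mxE. Qed.

Lemma Gdown_sym i j : Gdown X i j = Gdown X j i.
Proof.
apply/funext => x.
exact: etrans (GdownE i j x) (etrans (dot3C _ _) (esym (GdownE j i x))).
Qed.

Lemma Gdown_has_partials x i j : Omega x -> has_partials (Gdown X i j) x.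
Proof.
move=> Ox.
have -> : Gdown X i j = fun y => dot3 (Defs.basis X i y) (Defs.basis X j y).
  by apply/funext => y; rewrite GdownE.
by apply: dot3_has_partials; exact: basis_has_partials.
Qed.

Lemma det_metricE x : \det (metric X x) =
  Gdown X ord0 ord0 x * Gdown X ord_max ord_max x
  + (- 1) * (Gdown X ord0 ord_max x * Gdown X ord0 ord_max x).
Proof.
rewrite det2 mulN1r.
exact: (congr1 (fun r => _ - Gdown X ord0 ord_max x * r)
  (congr1 (@^~ x) (Gdown_sym ord_max ord0))).
Qed.

Lemma det_has_partials x : Omega x ->
  has_partials (fun y => \det (metric X y)) x.
Proof.
move=> Ox; rewrite (funext det_metricE).
have dG i j := @Gdown_has_partials x i j Ox.
exact: has_partials_discriminant.
Qed.

Lemma det_metric_gt0 x : Omega x -> 0 < \det (metric X x).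
Proof. by move=> Ox; apply: sym_pos_def_det_gt0; exact: spd. Qed.

Lemma Jac_gt0 x : Omega x -> 0 < Jac X x.
Proof. by move=> Ox; rewrite sqrtr_gt0 det_metric_gt0. Qed.

Lemma Jac_sqr x : Omega x -> Jac X x * Jac X x = \det (metric X x).
Proof. by move=> Ox; rewrite -expr2 sqr_sqrtr// ltW// det_metric_gt0. Qed.

Lemma Jac_has_partials x : Omega x -> has_partials (Jac X) x.
Proof.
by move=> Ox; exact: has_partials_sqrt (det_metric_gt0 Ox) (det_has_partials Ox).
Qed.

Lemma metric_unit x : Omega x -> metric X x \in unitmx.
Proof. by move=> Ox; rewrite unitmxE unitfE gt_eqF// det_metric_gt0. Qed.

Lemma Gup_Gdown x i j : Omega x ->
  \sum_(l < 2) Gup X i l x * Gdown X l j x = (i == j)%:R.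
Proof.
by move=> Ox; have /matrixP/(_ i j) := mulVmx (metric_unit Ox); rewrite !mxE.
Qed.

Lemma Gdown_Gup x i j : Omega x ->
  \sum_(l < 2) Gdown X i l x * Gup X l j x = (i == j)%:R.
Proof.
by move=> Ox; have /matrixP/(_ i j) := mulmxV (metric_unit Ox); rewrite !mxE.
Qed.

(** Cramer's rule shows the inverse metric to be as regular as the metric. *)
Lemma Gup_has_partials x i j : Omega x -> has_partials (Gup X i j) x.
Proof.
move=> Ox.
apply: (@has_partials_near _ (fun y => (\det (metric X y))^-1 *
  ((-1) ^+ (j + i) * Gdown X (lift j ord0) (lift i ord0) y))).
  apply: near_Omega => // y Oy; rewrite /Gup /invmx metric_unit// !mxE.
  by rewrite /cofactor det_mx11 [in RHS]mxE [in RHS]mxE.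
apply: has_partialsM.
  by apply: has_partialsV; [rewrite gt_eqF// det_metric_gt0|exact: det_has_partials].
by apply: has_partialsM; [exact: has_partials_cst|exact: Gdown_has_partials].
Qed.

(* Decides identities that hold for arbitrary values of the metric data at x,
   apart from the symmetry G_{10} = G_{01}. *)
Ltac metric_ring x :=
  let Gsym := fresh in
  have Gsym := congr1 (@^~ x) (Gdown_sym ord_max ord0);
  move: Gsym;
  move: (Gup X) (Gdown X) (christoffel X) (Jac X) (@partial R R);
  move=> ? ? ? ? ? /= Gsym; rewrite ?sum2 ?Gsym; by field.

(** With the upper index lowered, the inverse metric disappears and only
    derivatives of the metric remain. *)
Lemma lower_christoffel x m j k : Omega x ->
  \sum_(i < 2) Gdown X m i x * christoffel X i j k x =
  2^-1 * (partial j (Gdown X k m) x + partial k (Gdown X j m) x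
          - partial m (Gdown X j k) x).
Proof.
move=> Ox; pose E l := partial j (Gdown X k l) x
  + partial k (Gdown X j l) x - partial l (Gdown X j k) x.
transitivity (2^-1 * \sum_(l < 2)
    (\sum_(i < 2) Gdown X m i x * Gup X i l x) * E l).
  by rewrite /christoffel !sum2 /E; metric_ring x.
congr (_ * _); under eq_bigr => l _ do rewrite Gdown_Gup//.
by rewrite sum_deltal.
Qed.

Lemma christoffel_sym i j k x : christoffel X i j k x = christoffel X i k j x.
Proof.
rewrite /christoffel (Gdown_sym j k); congr (_ * _); apply: eq_bigr => l _.
by rewrite [partial j _ _ + _]addrC.
Qed.

(** The metric is covariantly constant.  In the sum of the two lowered
    Christoffel symbols, all derivatives of the metric but one cancel. *)
Lemma partial_Gdown x k i j : Omega x ->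
  partial k (Gdown X i j) x =
  \sum_(l < 2) Gdown X i l x * christoffel X l k j x
  + \sum_(l < 2) Gdown X j l x * christoffel X l k i x.
Proof.
move=> Ox; rewrite !lower_christoffel// (Gdown_sym j i) (Gdown_sym k i).
by rewrite (Gdown_sym k j); metric_ring x.
Qed.

(** The inverse metric is covariantly constant too: differentiating
    G^{il} G_{lm} = delta gives dG^{-1} = - G^{-1} dG G^{-1}, into which the
    derivative of the metric is inserted. *)
Lemma partial_Gup x k i j : Omega x ->
  partial k (Gup X i j) x =
  - (\sum_(l < 2) christoffel X i k l x * Gup X l j x
     + \sum_(l < 2) christoffel X j k l x * Gup X i l x).
Proof.
move=> Ox.
have dU a b := @Gup_has_partials x a b Ox.
have dD a b := @Gdown_has_partials x a b Ox.
(* The relation dG^{-1} G = - G^{-1} dG, to be multiplied by G^{mj}. *)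
have dUD m : \sum_(l < 2) partial k (Gup X i l) x * Gdown X l m x =
    - \sum_(l < 2) Gup X i l x * partial k (Gdown X l m) x.
  have : partial k (fun y => \sum_(l < 2) Gup X i l y * Gdown X l m y) x = 0.
    rewrite (@partial_near _ _ (fun=> (i == m)%:R)) ?partial_cst//.
    by apply: near_Omega => // y Oy; exact: Gup_Gdown.
  rewrite partial_sum; last by move=> l; exact: has_partialsM.
  under eq_bigr => l _ do rewrite partialM//.
  by rewrite big_split /= addrC => /eqP; rewrite addr_eq0 => /eqP.
transitivity (\sum_(l < 2) partial k (Gup X i l) x *
    \sum_(m < 2) Gdown X l m x * Gup X m j x).
  under eq_bigr => l _ do rewrite Gdown_Gup//.
  by rewrite sum_deltar.
transitivity (\sum_(m < 2)
    (\sum_(l < 2) partial k (Gup X i l) x * Gdown X l m x) * Gup X m j x).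
  by metric_ring x.
under eq_bigr => m _ do rewrite dUD.
transitivity (- (\sum_(a < 2) christoffel X j k a x * Gup X i a x
  + \sum_(a < 2) christoffel X i k a x * Gup X a j x)); last by rewrite addrC.
transitivity (- (\sum_(l < 2) Gup X i l x * \sum_(a < 2) christoffel X a k l x
    * (\sum_(m < 2) Gdown X a m x * Gup X m j x)
  + \sum_(m < 2) Gup X m j x * \sum_(a < 2) christoffel X a k m x
    * (\sum_(l < 2) Gup X i l x * Gdown X l a x))).
  move: (fun a b => partial_Gdown k a b Ox) (Gdown_sym ord_max ord0).
  move: (Gup X) (Gdown X) (christoffel X) (@partial R R) => U G Gam D dG Gsym.
  by rewrite !sum2 !dG !sum2 Gsym; ring.
congr (-%R _); congr (_ + _).
  apply: eq_bigr => l _; rewrite mulrC; congr (_ * _).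
  under eq_bigr => a _ do rewrite Gdown_Gup//.
  exact: sum_deltar.
apply: eq_bigr => l _; rewrite mulrC; congr (_ * _).
under eq_bigr => a _ do rewrite Gup_Gdown// mulrC.
exact: sum_deltal.
Qed.

(** The logarithmic derivative of det G is the trace of G^{-1} dG, which by
    compatibility is twice the trace of the Christoffel symbols; the square
    root halves it. *)
Lemma partial_Jac x k : Omega x ->
  partial k (Jac X) x = Jac X x * \sum_(l < 2) christoffel X l k l x.
Proof.
move=> Ox; have J0 := Jac_gt0 Ox; have dJ := Jac_has_partials Ox.
have dG i j := @Gdown_has_partials x i j Ox.
have ddet : partial k (fun y => \det (metric X y)) x =
    2 * \det (metric X x) * \sum_(l < 2) christoffel X l k l x.
  rewrite (funext det_metricE) (det_metricE x).
  rewrite (partial_discriminant _ (dG _ _) (dG _ _) (dG _ _)).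
  by rewrite (partial_Gdown _ ord0 ord0 Ox) (partial_Gdown _ ord0 ord_max Ox)
    (partial_Gdown _ ord_max ord_max Ox); metric_ring x.
have : partial k (fun y => Jac X y * Jac X y) x =
    partial k (fun y => \det (metric X y)) x.
  by apply: partial_near; apply: near_Omega => // y Oy; exact: Jac_sqr.
(* Differentiating J^2 = det G avoids the derivative of the square root. *)
rewrite partialM// ddet -Jac_sqr// => e.
apply: (mulfI (lt0r_neq0 J0)); lra.
Qed.

(** * Divergence of the momentum flux *)

(** Smoothness is given for the velocity vector [W] only; its components in the
    moving basis are G^{ij} (a_j . W). *)
Lemma components_has_partials x (u : 'I_2 -> 'rV[R]_2 -> R)
    (W : 'rV[R]_2 -> 'rV[R]_3) i : Omega x -> has_partials W x ->
  (forall y, Omega y -> W y = \sum_(j < 2) u j y *: Defs.basis X j y) ->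
  has_partials (u i) x.
Proof.
move=> Ox dW Wu.
apply: (@has_partials_near _ (fun y =>
  \sum_(j < 2) Gup X i j y * dot3 (Defs.basis X j y) (W y))); last first.
  apply: has_partials_sum => j; apply: has_partialsM.
    exact: Gup_has_partials.
  exact: dot3_has_partials (@basis_has_partials x j Ox) dW.
apply: near_Omega => // y Oy.
transitivity (\sum_(k < 2) (\sum_(j < 2) Gup X i j y * Gdown X j k y) * u k y).
  under eq_bigr => j _ do rewrite Wu// dot3_sumr mulr_sumr.
  rewrite exchange_big; apply: eq_bigr => k _; rewrite mulr_suml.
  by apply: eq_bigr => j _; rewrite GdownE [u k y * _]mulrC mulrA.
under eq_bigr => k _ do rewrite Gup_Gdown//.
exact: sum_deltal.
Qed.

(** The trace of the Christoffel symbols coming from the contracted index is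
    the logarithmic derivative of J. *)
Lemma divergence_tensor x (T : 'I_2 -> 'I_2 -> 'rV[R]_2 -> R) i : Omega x ->
  (forall j, has_partials (T i j) x) ->
  \sum_(j < 2) covd2 X T j i j x =
  (Jac X x)^-1 * \sum_(j < 2) partial j (fun y => Jac X y * T i j y) x
  + \sum_(j < 2) \sum_(l < 2) christoffel X i j l x * T l j x.
Proof.
move=> Ox dT; have J0 := lt0r_neq0 (Jac_gt0 Ox).
have dJ := Jac_has_partials Ox.
under [in RHS]eq_bigr => j _.
  rewrite (partialM _ dJ (dT j)) (partial_Jac _ Ox); over.
rewrite /covd2.
have := christoffel_sym ord_max ord0 ord_max x.
have := christoffel_sym ord0 ord0 ord_max x.
move: (Jac X) (christoffel X) (@partial R R) J0 => J Gam D J0 Gam0 Gam1.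
by rewrite !sum2 Gam0 Gam1; field.
Qed.

Lemma covd2D x (A B : 'I_2 -> 'I_2 -> 'rV[R]_2 -> R) k i j :
  has_partials (A i j) x -> has_partials (B i j) x ->
  covd2 X (fun a b y => A a b y + B a b y) k i j x =
  covd2 X A k i j x + covd2 X B k i j x.
Proof.
by move=> dA dB; rewrite /covd2 (partialD _ dA dB); metric_ring x.
Qed.

(** A covariantly constant inverse metric passes through the derivative. *)
Lemma covd2_pressure x (p : 'rV[R]_2 -> R) k i j : Omega x ->
  has_partials p x ->
  covd2 X (fun a b y => p y * Gup X a b y) k i j x =
  Gup X i j x * partial k p x.
Proof.
move=> Ox dp; rewrite /covd2 (partialM _ dp (@Gup_has_partials x i j Ox)).
by rewrite (partial_Gup _ _ _ Ox); metric_ring x.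
Qed.

Lemma raise_lower x (u : 'I_2 -> 'rV[R]_2 -> R) i : Omega x ->
  \sum_(k < 2) Gup X i k x * lower X u k x = u i x.
Proof.
move=> Ox.
transitivity (\sum_(j < 2) (\sum_(k < 2) Gup X i k x * Gdown X k j x) * u j x).
  by rewrite /lower; metric_ring x.
under eq_bigr => j _ do rewrite Gup_Gdown//.
exact: sum_deltal.
Qed.

(** Differentiating u^i = G^{ik} u_k, the derivative of G^{ik} yields two
    Christoffel terms; in the first one the lowered index is raised again. *)
Lemma partial_component x (u : 'I_2 -> 'rV[R]_2 -> R) i j : Omega x ->
  (forall k, has_partials (u k) x) ->
  partial j (u i) x =
  \sum_(k < 2) Gup X i k x * partial j (lower X u k) x
  - \sum_(k < 2) christoffel X i j k x * u k x
  - \sum_(k < 2) \sum_(l < 2)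
      Gup X i k x * christoffel X l j k x * lower X u l x.
Proof.
move=> Ox du.
have dU a b := @Gup_has_partials x a b Ox.
have dL k : has_partials (lower X u k) x.
  apply: has_partials_sum => l; apply: has_partialsM => //.
  exact: Gdown_has_partials.
have -> : partial j (u i) x =
    partial j (fun y => \sum_(k < 2) Gup X i k y * lower X u k y) x.
  by apply: partial_near; apply: near_Omega => // y Oy; rewrite raise_lower.
rewrite partial_sum; last by move=> k; exact: has_partialsM.
under eq_bigr => k _ do
  rewrite (partialM _ (dU _ _) (dL _)) (partial_Gup _ _ _ Ox).
under [X in _ - X - _]eq_bigr => k _ do rewrite -(raise_lower u k Ox).
move: (lower X u) => L; metric_ring x.
Qed.

(** The conservative form and its expansion by the product rule enter with
    weight one half each. *)
Lemma divergence_advection x (h : 'rV[R]_2 -> R) (u : 'I_2 -> 'rV[R]_2 -> R) i :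
  Omega x -> has_partials h x -> (forall k, has_partials (u k) x) ->
  \sum_(j < 2) covd2 X (fun a b y => h y * u a y * u b y) j i j x =
  (2 * Jac X x)^-1 *
    (\sum_(j < 2) partial j (fun y => Jac X y * h y * u i y * u j y) x
     + u i x * \sum_(j < 2) partial j (fun y => Jac X y * h y * u j y) x
     + \sum_(k < 2) \sum_(j < 2)
         Gup X i k x * Jac X x * h x * u j x * partial j (lower X u k) x)
  + 2^-1 *
    (\sum_(j < 2) \sum_(k < 2) christoffel X i j k x * h x * u j x * u k x
     - \sum_(j < 2) \sum_(k < 2) \sum_(l < 2)
         Gup X i k x * christoffel X l j k x * h x * u j x * lower X u l x).
Proof.
move=> Ox dh du; have J0 := lt0r_neq0 (Jac_gt0 Ox).
have dJhu j : has_partials (fun y => Jac X y * h y * u j y) x.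
  exact: has_partialsM (has_partialsM (Jac_has_partials Ox) dh) (du j).
have conservative :
    \sum_(j < 2) covd2 X (fun a b y => h y * u a y * u b y) j i j x =
    (Jac X x)^-1 *
      \sum_(j < 2) partial j (fun y => Jac X y * h y * u i y * u j y) x
    + \sum_(j < 2) \sum_(l < 2) christoffel X i j l x * (h x * u l x * u j x).
  have dT j : has_partials (fun y => h y * u i y * u j y) x.
    exact: has_partialsM (has_partialsM dh (du i)) (du j).
  rewrite (@divergence_tensor x (fun a b y => h y * u a y * u b y) i Ox dT).
  under eq_bigr => j _.
    rewrite (_ : (fun y => _) = fun y => Jac X y * h y * u i y * u j y); last first.
      by apply/funext => y; rewrite !mulrA.
    over.
  exact: erefl.
have product_rule :
    \sum_(j < 2) partial j (fun y => Jac X y * h y * u i y * u j y) x =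
    u i x * \sum_(j < 2) partial j (fun y => Jac X y * h y * u j y) x
    + \sum_(j < 2) Jac X x * h x * u j x * partial j (u i) x.
  rewrite mulr_sumr -big_split; apply: eq_bigr => j _ /=.
  have -> : (fun y => Jac X y * h y * u i y * u j y) =
      fun y => u i y * (Jac X y * h y * u j y).
    by apply/funext => y; rewrite [RHS]mulrCA mulrA.
  by rewrite (partialM _ (du i) (dJhu j)) [X in _ + X]mulrC.
have convective : \sum_(j < 2) Jac X x * h x * u j x * partial j (u i) x =
    \sum_(j < 2) Jac X x * h x * u j x *
      (\sum_(k < 2) Gup X i k x * partial j (lower X u k) x
       - \sum_(k < 2) christoffel X i j k x * u k x
       - \sum_(k < 2) \sum_(l < 2)
           Gup X i k x * christoffel X l j k x * lower X u l x).
  by apply: eq_bigr => j _; rewrite (partial_component _ _ Ox du).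
rewrite conservative product_rule convective.
set C := \sum_(j < 2) partial j (fun y => Jac X y * h y * u j y) x.
move: (lower X u) C => L C.
move: (Gup X) (christoffel X) (Jac X) (@partial R R) J0 => U Gam J D J0.
by rewrite !sum2; field.
Qed.

End Metric.

Theorem lemma2 (R : realType) (S : set 'rV[R]_3) (Omega : set 'rV[R]_2)
    (X : 'rV[R]_2 -> 'rV[R]_3) (I : set R) (g : R) (f b : 'rV[R]_2 -> R)
    (h : R -> 'rV[R]_2 -> R) (w : R -> 'rV[R]_2 -> 'rV[R]_3)
    (v : R -> 'I_2 -> 'rV[R]_2 -> R)
    (hS : surface S) (hX : local_param S Omega X) (hI : open I) (hg : 0 < g)
    (hsol : smooth_solution I Omega X g f b h w v)
    (t : R) (x : 'rV[R]_2) (ht : I t) (hx : Omega x) (i : 'I_2) :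
  \sum_(j < 2) covd2 X (momentum_flux X g (h t) (v t)) j i j x =
    (2 * Jac X x)^-1 *
      (\sum_(j < 2)
         partial j (fun y => Jac X y * h t y * v t i y * v t j y) x
       + v t i x *
         \sum_(j < 2) partial j (fun y => Jac X y * h t y * v t j y) x
       + \sum_(k < 2) \sum_(j < 2)
           Gup X i k x * Jac X x * h t x * v t j x
             * partial j (lower X (v t) k) x)
    + \sum_(j < 2) g * Gup X i j x * h t x * partial j (h t) x
    + 2^-1 *
      (\sum_(j < 2) \sum_(k < 2)
         christoffel X i j k x * h t x * v t j x * v t k x
       - \sum_(j < 2) \sum_(k < 2) \sum_(l < 2)
           Gup X i k x * christoffel X l j k x * h t x * v t j x
             * lower X (v t) l x).
Proof.
have [oO smX _ spd] := hX.
(* Regularity in space-time restricts to the slice at time t. *)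
have slice : differentiable (fun y : 'rV[R]_2 => (t, y)) x.
  by apply: differentiable_pair; [exact: differentiable_cst|exact: ex_diff].
have dh : has_partials (h t) x.
  apply: differentiable_has_partials.
  have dF := depth_smooth hsol [::] (conj ht hx : (I `*` Omega) (t, x)).
  exact: (differentiable_comp slice dF).
have dw : has_partials (w t) x.
  apply: differentiable_has_partials.
  have dF := velocity_smooth hsol [::] (conj ht hx : (I `*` Omega) (t, x)).
  exact: (differentiable_comp slice dF).
have dv j : has_partials (v t j) x.
  apply: (@components_has_partials _ _ _ oO smX spd x _ _ j hx dw) => y hy.
  exact: velocity_components hsol t y ht hy.
have dc : has_partials (fun=> g / 2) x by exact: has_partials_cst.
have dhh := has_partialsM dh dh.
have dp : has_partials (fun y => g / 2 * h t y ^+ 2) x.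
  exact: has_partialsM dc dhh.
have pressure j : covd2 X (fun a b y => g / 2 * h t y ^+ 2 * Gup X a b y) j i j x
    = g * Gup X i j x * h t x * partial j (h t) x.
  rewrite (covd2_pressure oO smX spd _ _ _ hx dp).
  rewrite (partialM j dc dhh : partial j (fun y => g / 2 * h t y ^+ 2) x = _).
  by rewrite (partialM j dh dh) partial_cst; field.
have -> : \sum_(j < 2) covd2 X (momentum_flux X g (h t) (v t)) j i j x =
    \sum_(j < 2) covd2 X (fun a b y => h t y * v t a y * v t b y) j i j x
    + \sum_(j < 2) g * Gup X i j x * h t x * partial j (h t) x.
  rewrite -big_split; apply: eq_bigr => j _ /=; rewrite -pressure.
  apply: covd2D; first exact: has_partialsM (has_partialsM dh (dv i)) (dv j).
  exact: has_partialsM dp (@Gup_has_partials _ _ _ oO smX spd x i j hx).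
by rewrite (divergence_advection oO smX spd _ hx dh dv) addrAC.
Qed.
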